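(* Let $n\ge 2$, let $F$ be a field of order greater than $2$, and let $\Sigma_n$ be the $n$-dimensional projective space over $F$. Let $A,B$ be two simplexes in $\Sigma_n$ with no common point and no common hyperplane (face). If $A,B$ are in perspective from a point, then they are in perspective from a hyperplane.
   Context: Dimension means projective dimension. A simplex in $\Sigma_n$ is a set of $n+1$ points that generates $\Sigma_n$; its faces (hyperplanes) are the $(n-1)$-dimensional subspaces generated by $n$ of its points. Simplexes $A=\{A_i\}$ and $B=\{B_i\}$ (with $n+1$ points each, $A_i$ corresponding to $B_i$) are in perspective from a point $V$ if there are $n+1$ lines through $V$, the $i$-th one containing $A_i$ and $B_i$. A $t$-space of $A$ is the $t$-dimensional subspace generated by $t+1$ points $A_i$, $i\in I$, $|I|=t+1$; the corresponding $t$-space of $B$ is generated by the points $B_i$, $i\in I$. Simplexes $A,B$ of $\Sigma_n$ with no common points or faces are in perspective from a hyperplane $v$ if there is a correspondence between the points of $A$ and $B$ (and therefore between their subspaces) such that for each $t=1,2,\ldots,n-1$ the intersection of corresponding $t$-spaces of $A,B$ is a $(t-1)$-dimensional subspace lying in the fixed hyperplane $v$. *)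

(* Defs.v *)
From mathcomp Require Import all_boot all_order all_algebra.

Set Implicit Arguments.
Unset Strict Implicit.
Unset Printing Implicit Defensive.

Import GRing.Theory.
Local Open Scope ring_scope.

(* The subspaces of the n-dimensional projective space over F are the linear
   subspaces of F^(n+1); inclusion, span and intersection are <=, + and :&:
   in scope %VS, and the zero subspace is the empty set of points. *)
Notation pspace F n := {vspace 'rV[F]_n.+1}.

(* Projective dimension is vector-space dimension minus one. *)
Definition has_pdim (F : fieldType) (n d : nat) (U : pspace F n) : Prop :=
  \dim U = d.+1.

Definition is_point (F : fieldType) (n : nat) (U : pspace F n) : Prop :=
  has_pdim 0 U.

Definition is_line (F : fieldType) (n : nat) (U : pspace F n) : Prop :=
  has_pdim 1 U.

Definition is_hyperplane (F : fieldType) (n : nat) (U : pspace F n) : Prop :=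
  has_pdim n.-1 U.

(* A simplex is indexed by 'I_n.+1; for two simplexes the indexing is the
   correspondence between their points.  Distinctness of the n+1 points
   follows from their generating the whole space. *)
Definition is_simplex (F : fieldType) (n : nat) (A : 'I_n.+1 -> pspace F n)
    : Prop :=
  (forall i, is_point (A i)) /\ (\sum_i A i)%VS = fullv.

(* The t-space of A on I, where t + 1 = #|I|. *)
Definition subspace_on (F : fieldType) (n : nat) (A : 'I_n.+1 -> pspace F n)
    (I : {set 'I_n.+1}) : pspace F n :=
  (\sum_(i in I) A i)%VS.

(* The face generated by the n points other than A i. *)
Definition face (F : fieldType) (n : nat) (A : 'I_n.+1 -> pspace F n)
    (i : 'I_n.+1) : pspace F n :=
  subspace_on A [set~ i].

Definition no_common_point (F : fieldType) (n : nat)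
    (A B : 'I_n.+1 -> pspace F n) : Prop :=
  forall i j, A i <> B j.

Definition no_common_face (F : fieldType) (n : nat)
    (A B : 'I_n.+1 -> pspace F n) : Prop :=
  forall i j, face A i <> face B j.

(* The lines are not required to be pairwise distinct. *)
Definition perspective_from_point (F : fieldType) (n : nat)
    (A B : 'I_n.+1 -> pspace F n) (V : pspace F n) : Prop :=
  is_point V /\
  exists l : 'I_n.+1 -> pspace F n, forall i,
    [/\ is_line (l i), (V <= l i)%VS, (A i <= l i)%VS & (B i <= l i)%VS].

Definition perspective_from_hyperplane (F : fieldType) (n : nat)
    (A B : 'I_n.+1 -> pspace F n) (v : pspace F n) : Prop :=
  is_hyperplane v /\
  forall t : nat, (1 <= t <= n.-1)%N ->
  forall I : {set 'I_n.+1}, #|I| = t.+1 ->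
    has_pdim t.-1 (subspace_on A I :&: subspace_on B I)%VS /\
    (subspace_on A I :&: subspace_on B I <= v)%VS.

(* Main.v *)
(* Write V = <[w]>.  As A_i and B_i are distinct points of a line through V,
   w = x_i + y_i with x_i in A_i and y_i in B_i.  Some x_i = 0 means V = B_i
   and some y_j = 0 means V = A_j; since A and B share no point, not both
   occur, so up to exchanging A and B all x_i are nonzero.  Then
   x_i - x_j = y_j - y_i lies in both t-spaces on any I containing i and j,
   and these differences span a subspace of projective dimension t - 1 inside
   the hyperplane spanned by all of them.  The intersection is no larger,
   since two equal corresponding t-spaces would contain V and hence extend to
   equal faces.  This covers the degenerate positions of V (a vertex of A or
   of B) as well. *)
Require Import Defs.
From mathcomp Require Import all_boot all_order all_algebra.

Set Implicit Arguments.
Unset Strict Implicit.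
Unset Printing Implicit Defensive.

Import GRing.Theory.
Local Open Scope ring_scope.

Lemma dim1_vline (K : fieldType) (vT : vectType K) (U : {vspace vT}) (u : vT) :
  \dim U = 1%N -> u \in U -> u != 0 -> U = <[u]>%VS.
Proof.
move=> dU uU u0; apply/esym/eqP.
by rewrite eqEdim -memvE uU dim_vline u0 dU.
Qed.

Section Simplex.

Variables (F : fieldType) (n : nat).
Implicit Types (A B : 'I_n.+1 -> pspace F n) (I J : {set 'I_n.+1}).

Lemma sub_subspace_on A I i : i \in I -> (A i <= subspace_on A I)%VS.
Proof. by move=> iI; apply: (sumv_sup i). Qed.

Lemma subspace_onS A I J : I \subset J ->
  (subspace_on A I <= subspace_on A J)%VS.
Proof.
by move=> /subsetP IJ; apply/subv_sumP => i /IJ; apply: sub_subspace_on.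
Qed.

(** The spans on [I] and on its complement together fill a space of vector dimension
    [#|I| + #|~: I|], and each has dimension at most its number of points; so both bounds are
    attained. *)
Lemma dim_subspace_on A I : is_simplex A -> \dim (subspace_on A I) = #|I|.
Proof.
move=> [A1 Afull].
have le_dim J : (\dim (subspace_on A J) <= #|J|)%N.
  apply: leq_trans (dimv_leq_sum _ _ _) _; rewrite -sum1_card.
  by apply: leq_sum => i _; rewrite A1.
apply/eqP; rewrite eqn_leq le_dim /=.
have : (#|I| + #|~: I| <=
    \dim (subspace_on A I) + \dim (subspace_on A (~: I)))%N.
  have -> : (#|I| + #|~: I|)%N = \dim (fullv : pspace F n).
    by rewrite cardsC card_ord dimvf /dim /= mul1n.
  apply: leq_trans (dimv_add_leqif _ _); apply: dimvS.
  rewrite -Afull; apply/subv_sumP => i _; have [iI|iI] := boolP (i \in I).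
    exact: subv_trans (sub_subspace_on _ iI) (addvSl _ _).
  by apply: subv_trans (addvSr _ _); apply: sub_subspace_on; rewrite inE.
by move=> le_card; rewrite -(leq_add2r #|~: I|) (leq_trans le_card) // leq_add2l le_dim.
Qed.

(** Equal spans would contain [a k] and [a k + w] for some [k] in [I], hence [w]. A face of [B]
    containing them then contains every [a i = (a i + w) - w] with [i] in that face, so it equals
    the corresponding face of [A]. *)
Lemma subspace_on_neq A B (a : 'I_n.+1 -> 'rV[F]_n.+1) (w : 'rV[F]_n.+1) I :
    is_simplex A -> is_simplex B -> no_common_face A B ->
    (forall i, A i = <[a i]>%VS) -> (forall i, a i + w \in B i) ->
  (0 < #|I| <= n)%N -> subspace_on A I <> subspace_on B I.
Proof.
move=> sA sB AB Aa awB /andP[/card_gt0P[k kI] In] eqI.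
have [j jI] : exists j, j \notin I.
  apply/existsP; rewrite -negb_forall; apply/negP => /forallP allI.
  have: #|I| = n.+1 by rewrite -[RHS]card_ord; apply: eq_card => i; rewrite allI.
  by move=> cI; rewrite cI ltnn in In.
have IJ : I \subset [set~ j].
  by apply/subsetP => i iI; rewrite !inE; apply: contraNneq jI => <-.
have wB : w \in subspace_on B [set~ j].
  apply: (subvP (subspace_onS B IJ)).
  rewrite -[w](addKr (a k)) addrC rpredB //.
    exact: (subvP (sub_subspace_on B kI)).
  by rewrite -eqI; apply: (subvP (sub_subspace_on A kI)); rewrite Aa memv_line.
apply: (AB j j); apply/eqP.
rewrite eqEdim /face !dim_subspace_on // leqnn andbT.
apply/subv_sumP => i iJ; rewrite Aa -memvE -[a i](addrK w) rpredB //.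
exact: (subvP (sub_subspace_on B iJ)).
Qed.

Lemma subspace_on_sub_differences A (a : 'I_n.+1 -> 'rV[F]_n.+1) I k :
    (forall i, A i = <[a i]>%VS) ->
  (subspace_on A I <= (\sum_(i in I) <[a i - a k]>) + <[a k]>)%VS.
Proof.
move=> Aa; apply/subv_sumP => i iI; rewrite Aa -memvE -[a i](subrK (a k)).
apply: memv_add; last exact: memv_line.
by apply: (subvP (sumv_sup i iI (subvv _))); apply: memv_line.
Qed.

(** Adjoining the single vector [a k] to the differences gives a space containing the span of [A] on
    [I], so at most one dimension is missing. *)
Lemma dim_differences_ge A (a : 'I_n.+1 -> 'rV[F]_n.+1) I k :
    is_simplex A -> (forall i, A i = <[a i]>%VS) ->
  (#|I| <= (\dim (\sum_(i in I) <[a i - a k]>)%VS).+1)%N.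
Proof.
move=> sA Aa; rewrite -(dim_subspace_on I sA).
apply: leq_trans (dimvS (subspace_on_sub_differences I k Aa)) _.
apply: leq_trans (dimv_add_leqif _ _) _.
by rewrite -[leqRHS]addn1 leq_add2l dim_vline leq_b1.
Qed.

(** The normalised case, asymmetric in [A] and [B] so that it can be applied in either order: one
    vector [w] carries a generator of each [A i] into [B i]. *)
Lemma perspective_from_hyperplane_of_translate A B
    (a : 'I_n.+1 -> 'rV[F]_n.+1) (w : 'rV[F]_n.+1) :
    (0 < n)%N -> is_simplex A -> is_simplex B -> no_common_face A B ->
    (forall i, A i = <[a i]>%VS) -> (forall i, a i + w \in B i) ->
  exists v, perspective_from_hyperplane A B v.
Proof.
move=> n0 sA sB AB Aa awB.
pose H := (\sum_(i in [set: 'I_n.+1]) <[a i - a ord0]>)%VS.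
have aH i : a i - a ord0 \in H.
  have iT : i \in [set: 'I_n.+1] by rewrite inE.
  exact: (subvP (sumv_sup i iT (subvv _)) _ (memv_line _)).
exists H; split.
  rewrite /is_hyperplane /has_pdim prednK //; apply/eqP; rewrite eqn_leq.
  apply/andP; split; last first.
    by have := dim_differences_ge setT ord0 sA Aa; rewrite cardsT card_ord.
  (* The generator at [ord0] is zero, which leaves only [n] of them. *)
  rewrite /H (big_setD1 ord0) ?inE //= subrr.
  rewrite (_ : <[0%R]>%VS = 0%VS) ?add0v; last first.
    by apply/eqP; rewrite -dimv_eq0 dim_vline eqxx.
  apply: leq_trans (dimv_leq_sum _ _ _) _.
  have cD : #|[set: 'I_n.+1] :\ ord0| = n.
    have := cardsD1 ord0 [set: 'I_n.+1].
    by rewrite cardsT card_ord inE add1n => -[].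
  rewrite -[X in (_ <= X)%N]cD -sum1_card; apply: leq_sum => i _.
  by rewrite dim_vline leq_b1.
move=> t /andP[t1 tn] I cI.
have tn' : (t < n)%N by rewrite -(prednK n0) ltnS.
have [k kI] : exists k, k \in I by apply/card_gt0P; rewrite cI.
pose S := (\sum_(i in I) <[a i - a k]>)%VS.
set C := (_ :&: _)%VS.
have SC : (S <= C)%VS.
  apply/subv_sumP => i iI; rewrite -memvE memv_cap; apply/andP; split.
    by rewrite rpredB //; [apply: (subvP (sub_subspace_on A iI))
      | apply: (subvP (sub_subspace_on A kI))]; rewrite Aa memv_line.
  (* The common translation by [w] cancels in differences. *)
  have -> : a i - a k = (a i + w) - (a k + w).
    by rewrite opprD addrACA subrr addr0.
  by rewrite rpredB //; [apply: (subvP (sub_subspace_on B iI))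
    | apply: (subvP (sub_subspace_on B kI))].
have St : (t <= \dim S)%N by rewrite -ltnS -cI; apply: dim_differences_ge sA Aa.
have Ct : (\dim C <= t)%N.
  (* A larger intersection would fill both [t]-spaces and make them equal, although [#|I| = t.+1] is
     at most [n]. *)
  rewrite leqNgt; apply/negP => tC.
  have CA : C = subspace_on A I.
    by apply/eqP; rewrite eqEdim capvSl dim_subspace_on // cI.
  have CB : C = subspace_on B I.
    by apply/eqP; rewrite eqEdim capvSr dim_subspace_on // cI.
  apply: (subspace_on_neq sA sB AB Aa awB (I := I)); first by rewrite cI.
  by rewrite -CA.
have dC : \dim C = t by apply/eqP; rewrite eqn_leq Ct (leq_trans St (dimvS SC)).
split; first by rewrite /has_pdim dC prednK.
(* The intersection is spanned by differences based at [k]; each is a difference of two generators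
   of [H], which are based at [ord0]. *)
have /eqP <- : S == C by rewrite eqEdim SC dC.
apply/subv_sumP => i iI; rewrite -memvE.
have -> : a i - a k = (a i - a ord0) - (a k - a ord0).
  by rewrite opprB addrA subrK.
exact: rpredB.
Qed.

Lemma line_points_addv (P Q l : pspace F n) :
    is_point P -> is_point Q -> P <> Q -> is_line l ->
  (P <= l)%VS -> (Q <= l)%VS -> (P + Q)%VS = l.
Proof.
move=> dP dQ PQ dl Pl Ql; apply/eqP; rewrite eqEdim subv_add Pl Ql /= dl.
rewrite ltnNge; apply/negP => d1; apply: PQ.
have eqP_ : P = (P + Q)%VS by apply/eqP; rewrite eqEdim addvSl dP.
have eqQ_ : Q = (P + Q)%VS by apply/eqP; rewrite eqEdim addvSr dQ.
by rewrite eqP_ -eqQ_.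
Qed.

End Simplex.

Theorem theorem8p2 (n : nat) (hn : (2 <= n)%N)
    (F : fieldType) (hF : exists s : seq F, uniq s /\ (2 < size s)%N)
    (A B : 'I_n.+1 -> pspace F n)
    (hA : is_simplex A) (hB : is_simplex B)
    (hpoint : no_common_point A B) (hface : no_common_face A B) :
  (exists V : pspace F n, perspective_from_point A B V) ->
  exists v : pspace F n, perspective_from_hyperplane A B v.
Proof.
case=> V [dV [l lP]]; have n0 := ltnW hn.
pose w := vpick V.
have wV : w \in V by apply: memv_pick.
have w0 : w != 0 by rewrite vpick0 -dimv_eq0 dV.
have /fin_all_exists[x xP] i : exists x, x \in A i /\ w - x \in B i.
  have [dl Vl Al Bl] := lP i.
  have := subvP Vl _ wV.
  rewrite -(line_points_addv (hA.1 i) (hB.1 i) (@hpoint i i) dl Al Bl).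
  by case/memv_addP=> x xA [y yB ->]; exists x; rewrite addrC addKr.
have [/forallP x0|] := boolP [forall i, x i != 0].
  (* The sign makes the translate of [- x i] equal to [w - x i], which lies in [B i]. *)
  apply: (@perspective_from_hyperplane_of_translate _ _ A B (fun i => - x i) w)
    => // i.
    by apply: dim1_vline (hA.1 i) _ _; rewrite ?oppr_eq0 // rpredN; case: (xP i).
  by rewrite addrC; case: (xP i).
rewrite negb_forall => /existsP[k]; rewrite negbK => /eqP xk.
have wBk : w \in B k by have [_] := xP k; rewrite xk subr0.
(* Here [w] spans [B k]; if [w - x i] vanished, [w] would also span [A i], a common point. *)
have y0 i : w - x i != 0.
  apply/eqP => /subr0_eq wx; apply: (@hpoint i k).
  rewrite (dim1_vline (hB.1 k) wBk w0).
  by apply: dim1_vline (hA.1 i) _ w0; rewrite wx; case: (xP i).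
(* Roles exchanged: [x i - w] generates [B i], and adding [w] gives [x i] in [A i]. *)
have [|||v [dv vP]] := @perspective_from_hyperplane_of_translate _ _ B A
  (fun i => x i - w) w n0 hB hA.
- by move=> i j /esym; apply: hface.
- move=> i; apply: dim1_vline (hB.1 i) _ _; rewrite -opprB ?oppr_eq0 //.
  by rewrite rpredN; case: (xP i).
- by move=> i; rewrite subrK; case: (xP i).
exists v; split=> // t tn I cI.
by rewrite capvC; apply: vP.
Qed.
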